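(* For every integer $n\ge 0$, let $$P_n=\{(x_1,\dots,x_n)\in[0,1]^n : x_i+x_{i+1}\le 1 \text{ for } i=1,\dots,n-1\},$$ and let $h_n(z)$ be the polynomial defined by $\mathrm{Ehr}_{P_n}(z)=\dfrac{h_n(z)}{(1-z)^{n+1}}$. Then $h_n(z)$ is palindromic for all $n$.
   Context: For $t\ge 1$, $L_{P_n}(t)=|tP_n\cap\mathbb{Z}^n|$, and the Ehrhart series of $P_n$ is $\mathrm{Ehr}_{P_n}(z)=1+\sum_{t\ge 1}L_{P_n}(t)z^t$. ($P_n$ is the graph polytope of the path graph with vertices $1,\dots,n$ and edges $i(i+1)$; for $n=0$, $P_0$ is a single point and $\mathrm{Ehr}_{P_0}(z)=1/(1-z)$.) A polynomial $p(z)$ of degree $m$ is palindromic if $z^m p(1/z)=p(z)$. *)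

(* Defs.v *)
From HB Require Import structures.
From mathcomp Require Import all_boot all_order all_algebra finmap.
From mathcomp Require Import all_classical reals.

Set Implicit Arguments.
Unset Strict Implicit.
Unset Printing Implicit Defensive.

Import Order.TTheory GRing.Theory Num.Theory.
Local Open Scope classical_set_scope.
Local Open Scope ring_scope.

(* Coordinates are indexed from 0. For n = 0 the space 'rV[R]_0 is a point and *)
(* all constraints are void.                                                   *)
Definition path_polytope (R : realType) (n : nat) : set 'rV[R]_n :=
  [set x | (forall i : 'I_n, 0 <= x 0 i <= 1) /\
           (forall i j : 'I_n, j = i.+1 :> nat -> x 0 i + x 0 j <= 1)].

Definition dilate (R : realType) (n t : nat) (P : set 'rV[R]_n) : set 'rV[R]_n :=
  [set t%:R *: x | x in P].

Definition integer_points (R : realType) (n : nat) : set 'rV[R]_n :=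
  [set x | forall i : 'I_n, x 0 i \is a Num.int].

(* fset_set sends an infinite set to fset0; for bounded P the set is finite. *)
Definition lattice_count (R : realType) (n : nat) (P : set 'rV[R]_n)
    (t : nat) : nat :=
  #|` fset_set (dilate t P `&` @integer_points R n)|.

(* Formal power series are represented by their coefficient sequences. *)
Definition series_mul (R : realType) (a b : nat -> R) : nat -> R :=
  fun k => \sum_(i < k.+1) a i * b (k - i)%N.

Definition series_of_poly (R : realType) (p : {poly R}) : nat -> R :=
  fun k => p`_k.

Definition ehrhart_series (R : realType) (n : nat) (P : set 'rV[R]_n) :
    nat -> R :=
  fun t => if t == 0%N then 1 else (lattice_count P t)%:R.

(* Ehr_P(z) = h(z) / (1 - z)^(n+1) as formal power series; the denominator is  *)
(* invertible because its constant coefficient is 1, so it is cleared.         *)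
Definition ehrhart_numerator (R : realType) (n : nat) (P : set 'rV[R]_n)
    (h : {poly R}) : Prop :=
  series_mul (ehrhart_series P) (series_of_poly ((1 - 'X) ^+ n.+1))
  =1 series_of_poly h.

(* z^m p(1/z) = p(z) as an identity of rational functions, with m = deg p and  *)
(* z the image of 'X in the fraction field of {poly R}.                        *)
Definition palindromic (R : realType) (p : {poly R}) : Prop :=
  let z : {fraction {poly R}} := FracField.tofrac 'X in
  z ^+ (size p).-1 * (map_poly (fun c : R => FracField.tofrac c%:P) p).[z^-1]
  = FracField.tofrac p.

(* Main.v *)
Require Import Defs.
From mathcomp Require Import all_boot all_order all_algebra.
From mathcomp Require Import finmap zify ring.
From mathcomp Require Import all_classical reals.

Set Implicit Arguments.
Unset Strict Implicit.
Unset Printing Implicit Defensive.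

Import Order.TTheory GRing.Theory Num.Theory.
Local Open Scope ring_scope.

(** Lattice points of the t-th dilate are words over the naturals whose
    consecutive sums are at most t.  Let [path_count R n t s] count those of
    length n whose first letter is at most s.  Summing over the first letter y
    leaves a word of length n - 1 whose first letter is at most t - y; hence, as
    a function of s, the count at level n is the discrete antiderivative,
    vanishing at s = -1, of y |-> path_count R (n - 1) t (t - y).  This recursion
    makes sense for all integers t and s, and the proof takes place there.

    Two facts come out of it by induction on n.  The count is a polynomial map of
    degree at most n in (t, s) ([path_count_polymap]), so the differences of
    order n + 1 of its diagonal L(t) = path_count R n t t, the Ehrhart counting
    function, vanish.  And the involution (t, s) |-> (-3 - t, -2 - s) multiplies
    it by (-1)^n ([path_count_reflect]), because it preserves the recursion up to
    sign and fixes the base line s = -1.  On the diagonal this yields a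
    reciprocity L(-c - t) = (-1)^n L(t), with c = 3 when n >= 2, while c = 2 for
    the segment and c = 1 for the point; moreover L vanishes at
    -1, ..., -(c - 1).

    The coefficients of the numerator are truncations of the alternating sums
    defining the differences of order n + 1.  As the complete sums vanish, a
    truncated sum is minus its complement, which the reciprocity turns into the
    truncated sum of index n + 1 - c - k ([numerator_coef_sym]); the coefficients
    of index above n + 1 - c vanish ([numerator_coef_large]).  The constant
    coefficient is L(0) = 1, so by the symmetry the degree is exactly n + 1 - c
    and the numerator is palindromic. *)

(** * Polynomial maps between abelian groups *)

(** Polynomial maps of degree less than d in Frechet's sense: all d-fold
    differences vanish.  This form, free of coordinates, makes stability under
    affine substitutions immediate. *)
Fixpoint polymap_lt (U W : zmodType) (d : nat) (f : U -> W) : Prop :=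
  if d is d'.+1 then forall v, polymap_lt d' (fun x => f (x + v) - f x)
  else forall x, f x = 0.

Lemma polymap_lt_ext (U W : zmodType) d (f g : U -> W) :
  f =1 g -> polymap_lt d f -> polymap_lt d g.
Proof. by move=> /funext ->. Qed.

Lemma polymap_ltD (U W : zmodType) d (f g : U -> W) :
  polymap_lt d f -> polymap_lt d g -> polymap_lt d (fun x => f x + g x).
Proof.
elim: d f g => [|d IH] f g /= Hf Hg => [x|v]; first by rewrite Hf Hg addr0.
apply: polymap_lt_ext (IH _ _ (Hf v) (Hg v)) => x /=.
by rewrite opprD addrACA.
Qed.

Lemma polymap_ltN (U W : zmodType) d (f : U -> W) :
  polymap_lt d f -> polymap_lt d (fun x => - f x).
Proof.
elim: d f => [|d IH] f /= Hf => [x|v]; first by rewrite Hf oppr0.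
by apply: polymap_lt_ext (IH _ (Hf v)) => x /=; rewrite opprD.
Qed.

Lemma polymap_lt_comp (U V W : zmodType) (p l : U -> V) d (f : V -> W) :
  (forall x v, p (x + v) = p x + l v) ->
  polymap_lt d f -> polymap_lt d (fun x => f (p x)).
Proof.
move=> pD; elim: d f => [|d IH] f /= Hf => [x|v]; first exact: Hf.
by apply: polymap_lt_ext (IH _ (Hf (l v))) => x /=; rewrite pD.
Qed.

Lemma polymap_lt_translate (U W : zmodType) (v : U) d (f : U -> W) :
  polymap_lt d f -> polymap_lt d (fun x => f (x + v)).
Proof.
by apply: (@polymap_lt_comp _ _ _ (fun x => x + v) id) => x w; rewrite addrAC.
Qed.

Lemma int_const (W : zmodType) (f : int -> W) (a : int) :
  (forall s, f (s + 1) = f s) -> forall s, f s = f a.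
Proof.
move=> H s; suff E x : f x = f 0 by rewrite !E.
elim: x => [//|n <-|n <-]; first by rewrite -(H n%:Z); congr f; lia.
by rewrite -H; congr f; lia.
Qed.

Lemma int_pairD (a b c d : int) :
  ((a, b) : int * int) + (c, d) = (a + c, b + d).
Proof. by []. Qed.

(** Summation in the second variable raises the degree by at most one, provided
    that it starts from zero on a fixed line: the increments in the first
    variable also vanish on that line, so the induction on d applies to them. *)
Lemma polymap_lt_antidiff (W : zmodType) (a : int) d (f : int * int -> W) :
  (forall t, f (t, a) = 0) ->
  polymap_lt d (fun x => f (x + (0, 1)) - f x) -> polymap_lt d.+1 f.
Proof.
elim: d f => [|d IH] f fa Hf.
  have f0 x : f x = 0.
    case: x => t s; rewrite -(fa t).
    apply: (@int_const _ (fun s => f (t, s))) => {}s.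
    by apply: subr0_eq; rewrite -(Hf (t, s)) int_pairD addr0.
  by move=> v x; rewrite !f0 subr0.
case=> b c.
(* The increment along (b, c) is the increment along (b, 0), to which the     *)
(* induction applies, plus a signed sum of unit vertical increments.          *)
have Hv : polymap_lt d.+1 (fun x => f (x + (0, c)) - f x).
  elim: c => [|n Hn|n Hn].
  - apply: (@polymap_lt_ext _ _ _ (fun=> 0)) => [x|].
      by rewrite -[(0, 0)]/(0 : int * int) addr0 subrr.
    by elim: {IH Hf} d => [|d IHd] v //=; rewrite subr0.
  - apply: polymap_lt_ext (polymap_ltD (polymap_lt_translate (0, n%:Z) Hf) Hn).
    move=> x /=; rewrite subrKA -addrA int_pairD addr0.
    by congr (f (x + (0, _)) - _); lia.
  - pose v : int * int := (0, - n.+1%:Z).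
    apply: polymap_lt_ext
      (polymap_ltD (polymap_ltN (polymap_lt_translate v Hf)) Hn).
    move=> x /=; rewrite opprB -(addrA x) int_pairD addr0.
    have -> : - n.+1%:Z + 1 = - n%:Z by lia.
    by rewrite subrKA.
have Hh : polymap_lt d.+1 (fun x => f (x + (b, 0)) - f x).
  apply: IH => [t|]; first by rewrite int_pairD addr0 !fa subrr.
  apply: polymap_lt_ext (Hf (b, 0)) => x /=.
  rewrite [x + _ + _]addrAC !opprB addrACA [RHS]addrACA; congr (_ + _).
  exact: addrC.
apply: polymap_lt_ext (polymap_ltD (polymap_lt_translate (0, c) Hh) Hv) => x /=.
by rewrite subrKA -addrA int_pairD add0r addr0.
Qed.

(** * Differences and powers of 1 - X *)

Lemma coef_1BX_exp (R : comNzRingType) m i :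
  ((1 - 'X) ^+ m : {poly R})`_i = (-1) ^+ i *+ 'C(m, i).
Proof.
elim: m i => [|m IH] i.
  by rewrite expr0 coef1 bin0n; case: i => // i; rewrite mulr0n.
case: i => [|i].
  by rewrite exprSr mulrBr mulr1 coefB coefMX IH bin0 subr0.
rewrite exprSr mulrBr mulr1 coefB coefMX !IH /= binS mulrnDr exprS mulN1r.
by rewrite !mulNrn.
Qed.

(** The left-hand side is the d-fold difference of f with step -1, since the
    polynomial (1 - X)^d in the shift operator acts as its d-fold iterate. *)
Lemma polymap_lt_diff (R : comNzRingType) d (f : int -> R) (k : int) :
  polymap_lt d f ->
  \sum_(i < d.+1) ((1 - 'X) ^+ d : {poly R})`_i * f (k - i%:Z) = 0.
Proof.
elim: d f => [|d IH] f Hf.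
  by rewrite big_ord1 expr0 coef1 mul1r [LHS]Hf.
pose q : {poly R} := (1 - 'X) ^+ d.
have qd : q`_d.+1 = 0 by rewrite coef_1BX_exp bin_small ?mulr0n.
transitivity (- \sum_(i < d.+1) q`_i * (f (k - i%:Z + (-1)) - f (k - i%:Z)));
  last by rewrite (IH _ (Hf (-1))) oppr0.
under [in RHS]eq_bigr do rewrite mulrBr.
rewrite sumrB opprB exprSr mulrBr mulr1.
under eq_bigr do rewrite coefB coefMX mulrBl.
rewrite sumrB; congr (_ - _); first by rewrite big_ord_recr /= qd mul0r addr0.
rewrite big_ord_recl /= mul0r add0r; apply: eq_bigr => i _.
by congr (_ * f _); rewrite /bump /=; lia.
Qed.

(** * The counting function on all integers *)

Section Antidiff.
Variables (W : zmodType).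

(** The sum of g over the integers from 0 to s, with the convention for reversed
    bounds that makes the recurrence [antidiffS] hold for every integer s. *)
Definition antidiff (g : int -> W) (s : int) : W :=
  match s with
  | Posz m => \sum_(y < m.+1) g y%:Z
  | Negz m => - \sum_(y < m) g (Negz y)
  end.

Lemma antidiffN1 g : antidiff g (-1) = 0.
Proof. by rewrite /= big_ord0 oppr0. Qed.

Lemma antidiffS g s : antidiff g (s + 1) = antidiff g s + g (s + 1).
Proof.
case: s => [m|[|m]].
- have -> : m%:Z + 1 = m.+1 by lia.
  by rewrite /= [LHS]big_ord_recr.
- by rewrite /= big_ord1 big_ord0 oppr0 add0r.
have -> : Negz m.+1 + 1 = Negz m by lia.
by rewrite /= [X in - X + _]big_ord_recr /= opprD addrNK.
Qed.
End Antidiff.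

Fixpoint path_count (R : comNzRingType) (n : nat) (t s : int) : R :=
  if n is m.+1 then antidiff (fun y => path_count R m t (t - y)) s else 1.

Arguments path_count : simpl never.

Lemma path_count_N1 (R : comNzRingType) n t : path_count R n.+1 t (-1) = 0.
Proof. exact: antidiffN1. Qed.

Lemma path_count_step (R : comNzRingType) n t s :
  path_count R n.+1 t (s + 1) =
  path_count R n.+1 t s + path_count R n t (t - (s + 1)).
Proof. exact: antidiffS. Qed.

Lemma path_count_polymap (R : comNzRingType) n :
  polymap_lt n.+1 (fun x : int * int => path_count R n x.1 x.2).
Proof.
elim: n => [|n IH]; first by move=> v x /=; rewrite subrr.
apply: (@polymap_lt_antidiff _ (-1)) => [t|]; first exact: path_count_N1.
pose p (x : int * int) := (x.1, x.1 - (x.2 + 1)).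
pose l (x : int * int) := (x.1, x.1 - x.2).
have pD x v : p (x + v) = p x + l v by congr (_, _); rewrite /=; lia.
apply: polymap_lt_ext (polymap_lt_comp pD IH) => -[t s].
by rewrite int_pairD addr0 /= path_count_step [RHS]addrC addKr.
Qed.

(** On the diagonal this amounts, for n >= 2, to Ehrhart reciprocity combined
    with the translation x |-> x - (1, ..., 1) from the interior lattice points
    of the t-th dilate onto the lattice points of the (t - 3)-th one.  Both sides
    satisfy the same recurrence in s and vanish at s = -1, which the substitution
    s |-> -2 - s fixes. *)
Lemma path_count_reflect (R : comNzRingType) n t s :
  path_count R n (- 3 - t) (- 2 - s) = (-1) ^+ n * path_count R n t s.
Proof.
elim: n t s => [|n IH] t s; first by rewrite mul1r.
apply/eqP; rewrite -subr_eq0; apply/eqP.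
rewrite [LHS](@int_const _ (fun s =>
  path_count R n.+1 (- 3 - t) (- 2 - s) -
  (-1) ^+ n.+1 * path_count R n.+1 t s) (-1)) => [|{}s].
  have -> : - 2 - (-1) = -1 :> int by [].
  by rewrite !path_count_N1 mulr0 subr0.
cbv beta; have -> : - 2 - s = (- 2 - (s + 1)) + 1 by lia.
rewrite !path_count_step mulrDr.
have -> : - 3 - t - (- 2 - (s + 1) + 1) = - 2 - (t - (s + 1)) by lia.
by rewrite IH exprS mulN1r !mulNr; ring.
Qed.

(** * Symmetry of the numerator *)

Section Numerator.
Variables (R : comNzRingType) (n m : nat) (f : int -> R).
Hypotheses (m_gt0 : (0 < m)%N) (m_le : (m <= n.+1)%N).
Hypothesis f_diff : forall k : int,
  \sum_(i < n.+2) ((1 - 'X) ^+ n.+1 : {poly R})`_i * f (k - i%:Z) = 0.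
Hypothesis f_zero : forall j : nat, (0 < j < m)%N -> f (- j%:Z) = 0.
Hypothesis f_reflect : forall t, f (- m%:Z - t) = (-1) ^+ n * f t.

Let c i := ((1 - 'X) ^+ n.+1 : {poly R})`_i.

Definition numerator_coef (k : nat) : R :=
  \sum_(0 <= i < k.+1) c i * f (k%:Z - i%:Z).

(** The sum differs from the vanishing full one only by terms with a zero
    binomial coefficient or with a value of f at -1, ..., -(m - 1). *)
Lemma numerator_coef_large k : (n.+1 - m < k)%N -> numerator_coef k = 0.
Proof.
move=> hk; have := f_diff k.
rewrite -(big_mkord xpredT (fun i => c i * f (k%:Z - i%:Z))) => Hk.
case: (leqP n.+1 k) => hnk.
  rewrite /numerator_coef (big_cat_nat (n := n.+2)) //= Hk add0r.
  rewrite big_nat big1 // => i /andP[hi _].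
  by rewrite /c coef_1BX_exp bin_small // mulr0n mul0r.
rewrite -[RHS]Hk [RHS](big_cat_nat (n := k.+1)) //=; last by lia.
rewrite [X in _ + X]big_nat [X in _ + X]big1 ?addr0 // => i /andP[h1 h2].
have -> : k%:Z - i%:Z = - (i - k)%N%:Z by lia.
by rewrite f_zero ?mulr0 //; lia.
Qed.

(** In the vanishing full sum at n.+1 - m - k, the terms beyond the truncation
    first meet the zeros of f at -1, ..., -(m - 1); the reflection sends the
    remaining ones, in reverse order, to the opposites of the terms of the
    truncation at k. *)
Lemma numerator_coef_sym k : (k <= n.+1 - m)%N ->
  numerator_coef (n.+1 - m - k) = numerator_coef k.
Proof.
move=> hk; set d := (n.+1 - m)%N; set k' := (d - k)%N.
have := f_diff k'.
rewrite -(big_mkord xpredT (fun i => c i * f (k'%:Z - i%:Z))).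
rewrite (big_cat_nat (n := k'.+1)) //=; last by rewrite /k' /d; lia.
rewrite [X in _ + X](big_cat_nat (n := (n.+1 - k)%N)) /=;
  try by rewrite /k' /d; lia.
rewrite [X in _ + (X + _)]big_nat [X in _ + (X + _)]big1 ?add0r
  => [|i /andP[h1 h2]]; last first.
  have -> : k'%:Z - i%:Z = - (i - k')%N%:Z by lia.
  by rewrite f_zero ?mulr0 //; move: h1 h2; rewrite /k' /d; lia.
move=> /eqP; rewrite addr_eq0 /numerator_coef => /eqP ->.
rewrite -{1}[(n.+1 - k)%N]add0n big_addn.
have -> : (n.+2 - (n.+1 - k))%N = k.+1 by lia.
rewrite big_nat_rev -sumrN /numerator_coef; apply: eq_big_nat => i hi.
have -> : (0 + k.+1 - i.+1 + (n.+1 - k))%N = (n.+1 - i)%N by lia.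
have -> : k'%:Z - (n.+1 - i)%N%:Z = - m%:Z - (k%:Z - i%:Z).
  by rewrite /k' /d; lia.
rewrite f_reflect /c !coef_1BX_exp bin_sub; last by lia.
have sE : (-1) ^+ n = - ((-1) ^+ (n.+1 - i) * (-1) ^+ i) :> R.
  by rewrite -exprD subnK ?exprS ?mulN1r ?opprK //; lia.
have aa : (-1) ^+ (n.+1 - i) * (-1) ^+ (n.+1 - i) = 1 :> R.
  by rewrite -expr2 sqrr_sign.
by rewrite sE mulNr mulrN opprK !mulrA mulrnAl aa mulr_natl.
Qed.
End Numerator.

Lemma palindromic_coef (R : realType) (p : {poly R}) :
  (forall i, (i < size p)%N -> p`_((size p).-1 - i) = p`_i) -> palindromic p.
Proof.
move=> hp; rewrite /palindromic /map_poly horner_poly.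
set z := FracField.tofrac 'X.
have z0 : z != 0 by rewrite tofrac_eq0 polyX_eq0.
rewrite -[in RHS](coefK p) poly_def rmorph_sum /=.
rewrite mulr_sumr [RHS](reindex_inj rev_ord_inj) /=.
apply: eq_bigr => i _; case: i => i /= hi.
have -> : (size p - i.+1 = (size p).-1 - i)%N by lia.
rewrite hp // -mul_polyC tofracM tofracXn -/z mulrCA; congr (_ * _).
have hip : (i <= (size p).-1)%N by case: (size p) hi.
by rewrite -{1}(subnK hip) exprD -mulrA exprVn mulfV ?mulr1 // expf_neq0.
Qed.

(** * Lattice points as words *)

(** Words of length n that may follow the letter a when consecutive sums are at
    most t.  Starting from a = 0 leaves the first letter bounded by t only. *)
Fixpoint words (n t a : nat) : seq (seq nat) :=
  if n is m.+1 then [seq y :: w | y <- iota 0 (t - a).+1, w <- words m t y]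
  else [:: [::]].

Arguments words : simpl never.

Lemma wordsS n t a : words n.+1 t a =
  [seq y :: w | y <- iota 0 (t - a).+1, w <- words n t y].
Proof. by []. Qed.

Lemma size_words (R : comNzRingType) n t a : (a <= t)%N ->
  (size (words n t a))%:R = path_count R n t (t%:Z - a%:Z).
Proof.
elim: n a => [|n IH] a ha //.
rewrite wordsS size_allpairs_dep sumnE big_map natr_sum.
have -> : t%:Z - a%:Z = (t - a)%N by lia.
rewrite -[iota _ _]/(index_iota 0 (t - a).+1) big_mkord.
apply: eq_bigr => i _; apply: IH.
by have := ltn_ord i; lia.
Qed.

Lemma words_uniq n t a : uniq (words n t a).
Proof.
elim: n a => [|n IH] a //; rewrite wordsS.
apply: (@allpairs_uniq_dep _ (fun=> _) _ (fun x y => x :: y)).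
  exact: iota_uniq.
  by move=> x _; apply: IH.
by move=> [x u] [y v] _ _ /= [-> ->].
Qed.

Lemma mem_words n t a w : (a <= t)%N ->
  (w \in words n t a) = (size w == n) && path (fun x y => (x + y <= t)%N) a w.
Proof.
elim: n a w => [|n IH] a w ha; first by case: w.
rewrite wordsS; case: w => [|y w].
  by apply/negP => /allpairsPdep [? [? [_ _]]].
apply/allpairsPdep/idP => [[x [u [hx hu [-> ->]]]]|].
  move: hx; rewrite mem_iota => hx; move: hu.
  by rewrite IH /= ?eqSS; [move=> /andP[-> ->]; rewrite andbT; lia | lia].
move=> /andP[hs /andP[hy hp]].
exists y, w; split=> //; first by rewrite mem_iota; lia.
have hyt : (y <= t)%N := leq_trans (leq_addl _ _) hy.
by rewrite IH //; apply/andP.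
Qed.

Definition word_point (R : realType) n (w : seq nat) : 'rV[R]_n :=
  \row_(i < n) (nth 0%N w i)%:R.
Arguments word_point : clear implicits.

(** In a word that follows the letter 0, each letter is at most t because its
    sum with the preceding one is; this is the bound from the unit cube. *)
Lemma lattice_points_words (R : realType) n t : (0 < t)%N ->
  (dilate t (@path_polytope R n) `&` @integer_points R n)%classic =
  [set` [fset x in map (word_point R n) (words n t 0)]%fset]%classic.
Proof.
move=> t0; have t0R : 0 < t%:R :> R by rewrite ltr0n.
apply/seteqP; split=> x /=.
  case=> -[y [h1 h2] <-] hint; rewrite inE.
  set x' := _ *: y in hint *.
  have xE i : x' 0 i = t%:R * y 0 i by rewrite mxE.
  pose w := [seq Num.truncn (x' 0 i) | i <- enum 'I_n].
  have szw : size w = n by rewrite size_map size_enum_ord.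
  have wE (i : 'I_n) : (nth 0%N w i)%:R = x' 0 i.
    rewrite (nth_map i) ?size_enum_ord // nth_ord_enum truncnK //.
    by rewrite -intrEge0 // xE mulr_ge0 ?ler0n //; case/andP: (h1 i).
  apply/mapP; exists w; last by apply/rowP => i; rewrite [RHS]mxE wE.
  rewrite mem_words // szw eqxx /=; apply/(pathP 0%N) => i; rewrite szw => hi.
  have {}wE j (hj : (j < n)%N) : (nth 0%N w j)%:R = t%:R * y 0 (Ordinal hj).
    by rewrite -xE -wE.
  rewrite -(ler_nat R) natrD.
  case: i hi => [|i] hi /=.
    rewrite add0r wE -[leRHS]mulr1 ler_pM2l //.
    by case/andP: (h1 (Ordinal hi)).
  rewrite (wE _ (ltnW hi)) wE -mulrDr -[leRHS]mulr1 ler_pM2l //.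
  exact: h2.
rewrite inE => /mapP[w].
rewrite mem_words // => /andP[/eqP szw /(pathP 0%N) hw] ->.
have wle i : (i < n)%N -> (nth 0%N w i <= t)%N.
  move=> hi; have := hw i; rewrite szw => /(_ hi).
  by apply: leq_trans; apply: leq_addl.
split; last by move=> i; rewrite mxE; apply: natr_int.
exists (t%:R^-1 *: word_point R n w); last first.
  by rewrite scalerA divff ?scale1r ?gt_eqF.
split=> [i|i j hij].
  rewrite !mxE mulr_ge0 ?invr_ge0 ?ler0n //=.
  by rewrite ler_pdivrMl // mulr1 ler_nat wle.
rewrite !mxE -mulrDr ler_pdivrMl // mulr1 -natrD ler_nat hij.
by have := hw i.+1; rewrite szw /= -hij; apply.
Qed.

Lemma lattice_count_path (R : realType) n t : (0 < t)%N ->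
  lattice_count (@path_polytope R n) t = size (words n t 0).
Proof.
move=> t0; rewrite /lattice_count lattice_points_words // set_fsetK card_fseq.
rewrite undup_id ?size_map // map_inj_in_uniq ?words_uniq //.
move=> u v; rewrite !mem_words // => /andP[/eqP su _] /andP[/eqP sv _] /rowP E.
apply: (@eq_from_nth _ 0%N); rewrite su ?sv // => i hi.
by have := E (Ordinal hi); rewrite !mxE => /eqP; rewrite eqr_nat => /eqP.
Qed.
(** * The Ehrhart series of the path polytope *)

Lemma series_mulE (R : realType) (a b : nat -> R) k :
  series_mul a b k = \sum_(0 <= i < k.+1) b i * a (k - i)%N.
Proof.
rewrite /series_mul (reindex_inj rev_ord_inj) /= big_mkord.
apply: eq_bigr => i _; rewrite subSS mulrC; congr (b _ * _).
by have := ltn_ord i; lia.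
Qed.

Lemma path_count_diag0 (R : comNzRingType) n : path_count R n 0 0 = 1.
Proof. by elim: n => [//|n IH]; rewrite [LHS]big_ord1. Qed.

(** For n >= 2, passing from s = -2 - t to s = -3 - t in [path_count_reflect]
    costs a term of level n - 1 at s = -1, which is zero.  At level 1 the count
    does not depend on t, so the reflection about -1 in s alone remains. *)
Lemma path_count_diag_codegree (R : comNzRingType) n t :
  path_count R n (- (minn n.+1 3)%:Z - t) (- (minn n.+1 3)%:Z - t) =
  (-1) ^+ n * path_count R n t t.
Proof.
case: n => [|[|n]]; first by rewrite mul1r.
  by rewrite -path_count_reflect; congr (path_count R 1 _ _);
     rewrite /minn /=; lia.
have -> : minn n.+3 3 = 3 by lia.
rewrite -path_count_reflect.
have -> : - 2 - t = - 3%:Z - t + 1 by lia.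
rewrite path_count_step.
have -> : - 3 - t - (- 3%:Z - t + 1) = -1 by lia.
by rewrite path_count_N1 addr0.
Qed.

Lemma path_count_diag_zero (R : comNzRingType) n j : (0 < j < minn n.+1 3)%N ->
  path_count R n (- j%:Z) (- j%:Z) = 0.
Proof.
case: j => [|[|[|j]]] //; case: n => [|[|n]] //; try by rewrite path_count_N1.
- move=> _; have := path_count_diag_codegree R n.+2 (-1).
  have -> : - (minn n.+3 3)%:Z - (-1) = - 2%:Z by lia.
  by rewrite path_count_N1 mulr0.
all: lia.
Qed.

Lemma path_count_diag_diff (R : comNzRingType) n (k : int) :
  \sum_(i < n.+2) ((1 - 'X) ^+ n.+1 : {poly R})`_i *
    path_count R n (k - i%:Z) (k - i%:Z) = 0.
Proof.
apply: (polymap_lt_diff (f := fun t => path_count R n t t)).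
by apply: (polymap_lt_comp (p := fun t => (t, t)) (l := fun t => (t, t)) _
  (path_count_polymap R n)).
Qed.

Lemma ehrhart_series_path (R : realType) n t :
  ehrhart_series (@path_polytope R n) t = path_count R n t t.
Proof.
rewrite /ehrhart_series; case: t => [|t] /=; first by rewrite path_count_diag0.
by rewrite lattice_count_path // size_words // subr0.
Qed.

Theorem mainTheorem5 (R : realType) (n : nat) :
  exists h : {poly R},
    unique (ehrhart_numerator (@path_polytope R n)) h /\ palindromic h.
Proof.
set m := minn n.+1 3; pose f t := path_count R n t t.
have [m0 mn] : (0 < m)%N /\ (m <= n.+1)%N by rewrite /m; lia.
pose d := (n.+1 - m)%N.
pose h := \poly_(k < d.+1) numerator_coef n f k.
have coefh k : h`_k = numerator_coef n f k.
  rewrite coef_poly ltnS; case: leqP => // hk.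
  by rewrite (numerator_coef_large m0 mn (@path_count_diag_diff R n)
    (@path_count_diag_zero R n)).
have symh k : (k <= d)%N -> h`_(d - k) = h`_k.
  move=> hk; rewrite !coefh (numerator_coef_sym m0 mn) //.
  - exact: path_count_diag_diff.
  - exact: path_count_diag_zero.
  - exact: path_count_diag_codegree.
have h0 : h`_0 = 1.
  rewrite coefh /numerator_coef big_nat1 coef_1BX_exp bin0 mul1r.
  exact: path_count_diag0.
have sh : size h = d.+1.
  apply/eqP; rewrite eqn_leq size_poly ltnNge; apply/negP => hs.
  have := oner_neq0 R; rewrite -h0 -symh // subn0 nth_default ?eqxx //.
have hE k : series_mul (ehrhart_series (@path_polytope R n))
    (series_of_poly ((1 - 'X) ^+ n.+1)) k = h`_k.
  rewrite series_mulE coefh; apply: eq_big_nat => i hi.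
  rewrite ehrhart_series_path; congr (_ * path_count R n _ _); lia.
exists h; split; last first.
  by apply: palindromic_coef => i; rewrite sh => hi; apply: symh.
split=> // h' hh'; apply/polyP => k.
by rewrite -hE hh'.
Qed.
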